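(* Let $\lambda>0$. There exists $b_0\in{\rm BMO}_{\triangle_\lambda}(\mathbb R_+)$ such that $[b_0,R_\lambda]$ is not of weak type $(1,1)$ on $(\mathbb R_+,\mu)$, i.e. there is no constant $C$ with $\mu(\{x\in\mathbb R_+:|[b_0,R_\lambda]f(x)|>t\})\le \frac Ct\|f\|_{L^1(\mathbb R_+,\mu)}$ for all $f$ and all $t>0$.
   Context: On $\mathbb R_+=(0,\infty)$, $d\mu(x)=x^{2\lambda}dx$; intervals are $B=(a,b)\subset\mathbb R_+$. ${\rm BMO}_{\triangle_\lambda}(\mathbb R_+)$: $f\in L^1_{loc}(\mu)$ with $\sup_B\frac1{\mu(B)}\int_B|f-f_B|d\mu<\infty$, $f_B=\frac1{\mu(B)}\int_Bf\,d\mu$. $R_\lambda=\frac{d}{dx}\triangle_\lambda^{-1/2}$ is the Bessel Riesz transform associated with $\triangle_\lambda=-\frac{d^2}{dx^2}-\frac{2\lambda}x\frac d{dx}$: $R_\lambda f(x)=\mathrm{p.v.}\int_0^\infty R_\lambda(x,y)f(y)d\mu(y)$, $R_\lambda(x,y)=-\frac{2\lambda}{\pi}\int_0^\pi\frac{(x-y\cos\theta)(\sin\theta)^{2\lambda-1}}{(x^2+y^2-2xy\cos\theta)^{\lambda+1}}d\theta$; $[b,R_\lambda]f=bR_\lambda f-R_\lambda(bf)$. *)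

(* Defs.v *)
From HB Require Import structures.
From mathcomp Require Import all_boot all_order all_algebra.
From mathcomp Require Import all_classical all_reals all_analysis.
Set Implicit Arguments. Unset Strict Implicit. Unset Printing Implicit Defensive.
Import Order.TTheory GRing.Theory Num.Theory.
Import numFieldNormedType.Exports.
Local Open Scope classical_set_scope.
Local Open Scope ring_scope.

Section BesselDefs.
Variable R : realType.
Variable lam : R.

Definition wmu (x : R) : R := x `^ (2 * lam).

Definition muB (A : set R) : \bar R :=
  (\int[lebesgue_measure]_(x in A) (wmu x)%:E)%E.

Definition L1mu (f : R -> R) : Prop :=
  lebesgue_measure.-integrable `]0, +oo[ (fun x => (f x * wmu x)%:E).

Definition L1norm (f : R -> R) : R :=
  Rintegral lebesgue_measure `]0, +oo[ (fun x => `|f x| * wmu x).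

Definition meanB (f : R -> R) (a b : R) : R :=
  Rintegral lebesgue_measure `]a, b[ (fun x => f x * wmu x) /
  Rintegral lebesgue_measure `]a, b[ wmu.

Definition BMO (f : R -> R) : Prop :=
  (forall a b : R, 0 <= a -> a < b ->
     lebesgue_measure.-integrable `]a, b[ (fun x => (f x * wmu x)%:E)) /\
  exists M : R, forall a b : R, 0 <= a -> a < b ->
     Rintegral lebesgue_measure `]a, b[
       (fun x => `|f x - meanB f a b| * wmu x) /
     Rintegral lebesgue_measure `]a, b[ wmu <= M.

Definition Rkernel (x y : R) : R :=
  - (2 * lam / pi) *
  Rintegral lebesgue_measure `[0, pi]
    (fun th => (x - y * cos th) * (sin th) `^ (2 * lam - 1) /
               (x ^+ 2 + y ^+ 2 - 2 * x * y * cos th) `^ (lam + 1)).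

Definition truncR (f : R -> R) (x eps : R) : R :=
  Rintegral lebesgue_measure [set y | 0 < y /\ eps < `|x - y|]
    (fun y => Rkernel x y * f y * wmu y).

Definition pvR (f : R -> R) (x L : R) : Prop :=
  (\forall eps \near 0^'+,
     lebesgue_measure.-integrable [set y | 0 < y /\ eps < `|x - y|]
       (fun y => (Rkernel x y * f y * wmu y)%:E)) /\
  (truncR f x eps @[eps --> 0^'+] --> L).

(* [b,R_lambda] f (x) = b(x) R_lambda f(x) - R_lambda(b f)(x) is defined
   and |[b,R_lambda] f (x)| > t *)
Definition comm_gt (b f : R -> R) (t x : R) : Prop :=
  exists L1 L2 : R, pvR f x L1 /\ pvR (fun y => b y * f y) x L2 /\
    t < `|b x * L1 - L2|.

End BesselDefs.

(* Main.v *)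
Require Import Defs.
From HB Require Import structures.
From mathcomp Require Import all_boot all_order all_algebra.
From mathcomp Require Import all_classical all_reals all_analysis.
From mathcomp Require Import measurable_realfun ring lra.
Import Order.TTheory GRing.Theory Num.Theory.
Import numFieldNormedType.Exports.
Local Open Scope classical_set_scope.
Local Open Scope ring_scope.

(** Take [b0 = ln] and [f] the indicator of [(0, e)].  For [x] in [[1, 2]] and
    [y < 1/4] the kernel [R_lam(x, y)] is nonsingular and lies between two
    negative constants, so
      [|[ln, R_lam] f (x)| = |int_0^e (ln x - ln y) R_lam(x, y) dmu(y)|
        >= c ln(1/e) ||f||_1]
    throughout [[1, 2]].  A weak type bound would give
    [mu [1, 2] <= C' / ln(1/e)] for every small [e]: absurd as [e -> 0].
    The delicate point is that the kernel is finite when [lam < 1/2], i.e.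
    that [sin^(2 lam - 1)] is integrable on [[0, pi]]. *)

(** * Integrals of powers of the sine over [[0, pi]] *)

(** If the integral vanished, the nonnegative [f] would be zero almost everywhere on [D]; being
    positive there, it would force [D] to be null. *)
Lemma Rintegral_gt0 (d : measure_display) (T : measurableType d) (R : realType)
    (mu : {measure set T -> \bar R}) (D : set T) (f : T -> R) :
  measurable D -> mu D != 0%E -> mu.-integrable D (EFin \o f) ->
  (forall x, D x -> 0 < f x) -> 0 < Rintegral mu D f.
Proof.
move=> mD D0 intf f0.
have fge0 x : D x -> 0 <= f x by move/f0/ltW.
rewrite lt_neqAle Rintegral_ge0// andbT eq_sym.
apply: contra D0 => /eqP i0; apply/eqP.
have : ae_eq mu D (EFin \o f) (cst 0%E).
  apply/ae_eq_integral_abs => //; first exact: measurable_int intf.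
  rewrite (eq_integral (EFin \o f)); last first.
    by move=> x; rewrite inE => /fge0 h; rewrite /= ger0_norm.
  by rewrite -(fineK (integrable_fin_num mD intf)); congr EFin.
move=> [N [mN N0 DN]].
apply: (subset_measure0 mD mN _ N0) => x Dx; apply: DN => /= /(_ Dx) -[].
by move/eqP; rewrite gt_eqF// f0.
Qed.

Lemma powR_le1 (R : realType) (a r : R) : 0 <= a <= 1 -> 0 <= r -> a `^ r <= 1.
Proof.
move=> /andP[a0 a1] r0; have {1}-> : 1 = 1 `^ r :> R by rewrite powR1.
by rewrite ge0_ler_powR ?nnegrE.
Qed.

Lemma measurable_sin_powR (R : realType) (r : R) (D : set R) :
  measurable_fun D (fun x => sin x `^ r).
Proof.
apply: (@measurableT_comp _ _ _ _ _ _ (@powR R ^~ r)) => //.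
apply: measurable_funTS.
apply: continuous_measurable_fun.
exact: continuous_sin.
Qed.

Section sin_powR.
Context {R : realType}.
Variable q : R.
Hypothesis q0 : 0 < q.

Let is_derive_sinpowR (r x : R) : 0 < sin x ->
  is_derive x 1 (fun t => sin t `^ r) (r * sin x `^ (r - 1) * cos x).
Proof.
move=> sx; have := @is_derive1_comp R (@powR R ^~ r) sin x.
move=> /(_ (r * sin x `^ (r - 1)) (cos x)).
rewrite /comp; apply.
exact: is_derive1_powR.
Qed.

(* [H' = h >= q sin^(q - 1)], while [H] is bounded on [[0, pi]]. *)
Let H (x : R) := sin x `^ q * cos x + (q + 1) * x.
Let h (x : R) := q * sin x `^ (q - 1) + (q + 1) * (1 - sin x `^ (q + 1)).

(** Since cos^2 = 1 - sin^2, the product sin^q cos has derivative q sin^(q - 1) - (q + 1) sin^(q +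
    1). The linear term of [H] turns the negative part into (q + 1)(1 - sin^(q + 1)), which is
    nonnegative. *)
Let derH x : 0 < sin x -> is_derive x 1 H (h x).
Proof.
move=> sx; have D1 := is_derive_sinpowR q x sx.
have D2 := is_derive_cos x.
have D3 := is_deriveD (is_deriveM D1 D2)
  (is_deriveM (is_derive_cst (q + 1) x 1) (is_derive_id x 1)).
apply: is_derive_eq D3 _.
rewrite /h /GRing.scale/= !mulr0 addr0 mulr1 mulrDr mulr1.
have c2 : cos x * cos x = 1 - sin x * sin x by rewrite -!expr2 cos2sin2.
have -> : sin x `^ q = sin x `^ (q - 1) * sin x.
  rewrite -{3}[sin x]powRr1 ?ltW// -powRD ?subrK//.
  by rewrite (gt_eqF sx) implybT.
have -> : sin x `^ (q + 1) = sin x `^ (q - 1) * sin x * sin x.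
  rewrite -{3 4}[sin x]powRr1 ?ltW// -!powRD ?subrK// ?(gt_eqF sx) ?implybT//.
rewrite mulrCA c2 /cst; ring.
Qed.

Let h_ge x : 0 <= sin x -> q * sin x `^ (q - 1) <= h x.
Proof.
move=> sx; rewrite /h lerDl; apply: mulr_ge0; first by rewrite addr_ge0 ?(ltW q0).
rewrite subr_ge0.
by rewrite powR_le1 ?sx ?sin_le1 ?addr_ge0 ?(ltW q0).
Qed.

(** By the fundamental theorem of calculus the integral of [h] is [H b - H a]. The two endpoint
    values of sin^q cos contribute at most 2, the linear term at most (q + 1) pi; the factor 1/q
    comes from [h_ge]. The bound does not depend on [a] and [b]. *)
Let integral_sin_powR_cc a b : 0 < a -> a < b -> b < pi ->
  (\int[lebesgue_measure]_(x in `[a, b]) (sin x `^ (q - 1))%:E <=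
     ((2 + (q + 1) * pi) / q)%:E)%E.
Proof.
move=> a0 ab bpi.
have sin0 x : x \in `[a, b] -> 0 < sin x.
  rewrite in_itv/= => /andP[ax xb]; apply: sin_gt0_pi.
  by rewrite (lt_le_trans a0 ax) (le_lt_trans xb bpi).
have cH x : x \in `[a, b] -> {for x, continuous H}.
  move=> /sin0/derH dH; apply: differentiable_continuous.
  exact/derivable1_diffP.
have ch : {within `[a, b], continuous h}.
  apply: continuous_in_subspaceT => x; rewrite inE/= => xab.
  have dS r : {for x, continuous (fun t => sin t `^ r)}.
    apply: differentiable_continuous; apply/derivable1_diffP.
    exact: (@ex_derive _ _ _ _ _ _ _ (is_derive_sinpowR r x (sin0 _ xab))).
  apply: cvgD; first by apply: cvgM; [exact: cvg_cst|exact: dS].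
  apply: cvgM; first exact: cvg_cst.
  by apply: cvgB; [exact: cvg_cst|exact: dS].
have FTC : (\int[lebesgue_measure]_(x in `[a, b]) (h x)%:E = (H b)%:E - (H a)%:E)%E.
  apply: continuous_FTC2 => //.
  - split.
    + move=> x xab; have /sin0/derH dH : x \in `[a, b] by exact: subset_itv_oo_cc xab.
      exact: ex_derive.
    + apply: cvg_at_right_filter; apply: cH; by rewrite in_itv/= lexx ltW.
    + apply: cvg_at_left_filter; apply: cH; by rewrite in_itv/= lexx ltW.
  - move=> x xab; have /sin0/derH dH : x \in `[a, b] by exact: subset_itv_oo_cc xab.
    by rewrite derive1E; exact: derive_val.
have Hle : H b - H a <= 2 + (q + 1) * pi.
  have Hb x : x \in `[a, b] -> `|sin x `^ q * cos x| <= 1.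
    move=> /sin0 sx; rewrite normrM mulr_ile1// ?cos_max//.
    rewrite ger0_norm ?powR_ge0//.
    by rewrite powR_le1 ?sin_le1 ?(ltW q0) ?(ltW sx).
  have /Hb : a \in `[a, b] by rewrite in_itv/= lexx ltW.
  have /Hb : b \in `[a, b] by rewrite in_itv/= lexx ltW.
  rewrite !ler_norml => /andP[_ Hbb] /andP[Haa _].
  have : (q + 1) * (b - a) <= (q + 1) * pi.
    by rewrite ler_pM2l ?addr_gt0//; lra.
  by rewrite /H; lra.
have : (\int[lebesgue_measure]_(x in `[a, b]) (q%:E * (sin x `^ (q - 1))%:E) <=
    (2 + (q + 1) * pi)%:E)%E.
  apply: (@le_trans _ _ (\int[lebesgue_measure]_(x in `[a, b]) (h x)%:E)%E).
    apply: ge0_le_integral => //.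
    - by move=> x _; rewrite -EFinM lee_fin mulr_ge0 ?powR_ge0 ?(ltW q0).
    - by apply: measurable_funeM; apply/measurable_EFinP; exact: measurable_sin_powR.
    - apply/measurable_EFinP; apply: subspace_continuous_measurable_fun => //.
    - by move=> x /= xab; rewrite -EFinM lee_fin h_ge// ltW// sin0.
  by rewrite FTC -EFinB lee_fin.
rewrite ge0_integralZl//; last 3 first.
- by apply/measurable_EFinP; exact: measurable_sin_powR.
- by move=> x _; rewrite lee_fin powR_ge0.
- by rewrite lee_fin ltW.
by rewrite EFinM lee_pdivlMr// muleC.
Qed.

(** The uniform bound on compact subintervals passes to the open interval by monotone convergence;
    the two endpoints form a null set. *)
Lemma integrable_sin_powR :
  lebesgue_measure.-integrable `[0, pi] (fun x => (sin x `^ (q - 1))%:E).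
Proof.
have mS D : measurable_fun D (fun x => (sin x `^ (q - 1))%:E).
  by apply/measurable_EFinP; exact: measurable_sin_powR.
apply/integrableP; split; first exact: mS.
under eq_integral do rewrite gee0_abs ?lee_fin ?powR_ge0//.
rewrite -integral_itv_obnd_cbnd// -integral_itv_bndo_bndc//.
pose F (n : nat) : set R := `[n.+1%:R^-1, pi - n.+1%:R^-1]%classic.
have Fle (n m : nat) : (n <= m)%N -> m.+1%:R^-1 <= n.+1%:R^-1 :> R.
  by move=> nm; rewrite lef_pV2 ?posrE// ler_nat.
have F1 (n : nat) : 0 < (n.+1%:R^-1 : R) <= 1.
  by rewrite invr_gt0 ltr0Sn/= invf_le1// ler1n.
have pi2 := pi_ge2 R.
have FE : `]0, pi[%classic = \bigcup_n F n.
  apply/seteqP; split => [x /=|x [n _]]; rewrite /F /= !in_itv/= => /andP[x0 xpi].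
    (* [m] is the distance from [x] to the endpoints; any n with 1/(n + 1) <= m puts [x] in
       [F n]. *)
    pose m := Num.min x (pi - x).
    have m0 : 0 < m by rewrite lt_min x0 subr_gt0.
    exists (Num.truncn m^-1) => //; rewrite /F /= in_itv/=.
    have : (Num.truncn m^-1).+1%:R^-1 <= m.
      by rewrite invf_ple ?posrE// ltW// truncnS_gt.
    rewrite le_min; move: (_.+1%:R^-1) => u /andP[? ?].
    by apply/andP; split; lra.
  by move: (F1 n) x0 xpi; move: (n.+1%:R^-1) => u /andP[? ?] ? ?;
  apply/andP; split; lra.
have cvgF : (\int[lebesgue_measure]_(x in F n) (sin x `^ (q - 1))%:E @[n --> \oo] -->
   \int[lebesgue_measure]_(x in `]0%R, pi[) (sin x `^ (q - 1))%:E)%E.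
  rewrite FE; apply: ge0_nondecreasing_set_cvg_integral => //.
  - move=> n m nm; rewrite subsetEset => x; rewrite /F /= !in_itv/=.
    move: (Fle _ _ nm); move: (m.+1%:R^-1) (n.+1%:R^-1) => u v ? /andP[? ?].
    by apply/andP; split; lra.
  - by move=> i; exact: measurable_itv.
  - by move=> i; exact: mS.
  - by move=> i x Fx; rewrite lee_fin powR_ge0.
rewrite -(cvg_lim _ cvgF)//.
apply: (@le_lt_trans _ _ ((2 + (q + 1) * pi) / q)%:E); last exact: ltry.
apply: lime_le; first by apply/cvg_ex; eexists; exact: cvgF.
near=> n.
apply: integral_sin_powR_cc.
- by have /andP[] := F1 n.
(* For n >= 1 the cut-off is at most 1/2, so pi >= 2 makes [F n] a nondegenerate interval. *)
- have : n.+1%:R^-1 <= 2^-1 :> R.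
    by rewrite lef_pV2 ?posrE// ler_nat ltnS; near: n; exact: nbhs_infty_ge.
  by move: (n.+1%:R^-1) => u ?; lra.
- by move: (F1 n); move: (n.+1%:R^-1) => u /andP[? ?]; lra.
Unshelve. all: by end_near. Qed.

Lemma Rintegral_sin_powR_gt0 :
  0 < Rintegral lebesgue_measure `[0, pi] (fun x : R => sin x `^ (q - 1)).
Proof.
(* The endpoints, where the sine vanishes, are dropped so that the integrand is strictly positive
   throughout. *)
rewrite -Rintegral_itv_obnd_cbnd; last first.
  by apply: integrableS integrable_sin_powR => //; exact: subset_itv_oc_cc.
rewrite -Rintegral_itv_bndo_bndc; last first.
  by apply: integrableS integrable_sin_powR => //; exact: subset_itv_oo_cc.
have muE : lebesgue_measure (`]0, pi[%classic : set R) = pi%:E.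
  by rewrite lebesgue_measure_itv/= lte_fin pi_gt0 oppr0 adde0.
apply: Rintegral_gt0 => //.
- apply/eqP => /(etrans (esym muE)) /eqP.
  by rewrite eqe gt_eqF// pi_gt0.
- by apply: integrableS integrable_sin_powR => //; exact: subset_itv_oo_cc.
- by move=> x /=; rewrite in_itv/= => x0; exact/powR_gt0/sin_gt0_pi.
Qed.

End sin_powR.

(** * The weighted measure, and the logarithm as a BMO function *)

Lemma integrable_itvoo_bounded (R : realType) (f : R -> R) (a b M : R) :
  measurable_fun `]a, b[ f -> (forall x, a < x < b -> `|f x| <= M) ->
  lebesgue_measure.-integrable `]a, b[ (fun x => (f x)%:E).
Proof.
move=> mf fM; apply: measurable_bounded_integrable => //.
- have /= -> := lebesgue_measure_itv `]a, b[.
  by case: ifPn => // _; rewrite -EFinB ltry.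
- exists M; split; first exact: num_real.
  move=> N MN x /=; rewrite in_itv/= => /fM fxM.
  by rewrite (le_trans fxM)// ltW.
Qed.

Section weight.
Context {R : realType}.
Variable lam : R.
Hypothesis lam0 : 0 < lam.
Local Notation mu := (@lebesgue_measure R).

Let lam2 : 0 < 2 * lam. Proof. by rewrite mulr_gt0. Qed.

Lemma measurable_wmu (D : set R) : measurable_fun D (wmu lam).
Proof. by apply: measurable_funTS; exact: measurable_powR. Qed.

Lemma wmu_ge0 x : 0 <= wmu lam x.
Proof. exact: powR_ge0. Qed.

Lemma wmu_le x y : 0 <= x -> x <= y -> wmu lam x <= wmu lam y.
Proof.
move=> x0 xy; rewrite /wmu ge0_ler_powR ?nnegrE// ?(ltW lam2)//.
exact: le_trans xy.
Qed.

Lemma integrable_wmu (a b : R) : 0 <= a ->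
  mu.-integrable `]a, b[ (fun x => (wmu lam x)%:E).
Proof.
move=> a0; apply: (@integrable_itvoo_bounded _ _ _ _ (wmu lam b)).
  exact: measurable_wmu.
move=> x /andP[ax xb]; rewrite ger0_norm ?wmu_ge0// wmu_le// ?(ltW xb)//.
by rewrite (le_trans a0)// ltW.
Qed.

(** Only the right half of the interval is kept: it has length (b - a)/2, and its points exceed (a +
    b)/2 >= b/2. *)
Lemma Rintegral_wmu_ge (a b : R) : 0 <= a -> a < b ->
  wmu lam (b / 2) * ((b - a) / 2) <= Rintegral mu `]a, b[ (wmu lam).
Proof.
move=> a0 ab; have mid : a < (a + b) / 2 < b by apply/andP; split; lra.
have /andP[am mb] := mid.
have m0 : 0 <= (a + b) / 2 by lra.
have <- : Rintegral mu `](a + b) / 2, b[ (cst (wmu lam (b / 2))) =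
    wmu lam (b / 2) * ((b - a) / 2).
  rewrite Rintegral_cst//; congr (_ * _).
  have /= -> := lebesgue_measure_itv `](a + b) / 2, b[.
  by rewrite lte_fin mb -EFinB/=; lra.
apply: (@le_trans _ _ (Rintegral mu `](a + b) / 2, b[ (wmu lam))).
  apply: le_Rintegral => //.
  - apply: (@integrable_itvoo_bounded _ _ _ _ `|wmu lam (b / 2)|) => //.
  - exact: integrable_wmu.
  - move=> x /=; rewrite in_itv/= => /andP[x1 x2]; apply: wmu_le; lra.
apply: fine_le.
- exact: integrable_fin_num (integrable_wmu _ _ m0).
- exact: integrable_fin_num (integrable_wmu _ _ a0).
- apply: ge0_subset_integral => //.
  + by apply/measurable_EFinP; exact: measurable_wmu.
  + by move=> x _; rewrite lee_fin wmu_ge0.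
  + by apply: subset_itv; rewrite bnd_simp// ltW.
Qed.

Lemma Rintegral_wmu_gt0 (a b : R) : 0 <= a -> a < b ->
  0 < Rintegral mu `]a, b[ (wmu lam).
Proof.
move=> a0 ab; apply: lt_le_trans (Rintegral_wmu_ge _ _ a0 ab).
by rewrite mulr_gt0 ?powR_gt0//; lra.
Qed.

(** Any constant may replace the mean at the price of a factor 2: |f - m| <= |f - c| + |c - m|, and
    |c - m| times the mass of the interval is at most the integral of |f - c|. *)
Lemma meanB_oscillation_le (f : R -> R) (a b c : R) : 0 <= a -> a < b ->
  mu.-integrable `]a, b[ (fun x => (f x * wmu lam x)%:E) ->
  Rintegral mu `]a, b[ (fun x => `|f x - meanB lam f a b| * wmu lam x) <=
  2 * Rintegral mu `]a, b[ (fun x => `|f x - c| * wmu lam x).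
Proof.
move=> a0 ab fw; have W0 := Rintegral_wmu_gt0 _ _ a0 ab.
have iw := integrable_wmu a b a0.
have icw k : mu.-integrable `]a, b[ (fun x => (k * wmu lam x)%:E).
  by apply: eq_integrable (integrableZl _ k iw) => // x _; rewrite EFinM.
have idw k : mu.-integrable `]a, b[ (EFin \o (fun x => (f x - k) * wmu lam x)).
  rewrite (_ : _ \o _ =
    (fun x => (f x * wmu lam x)%:E) \- (fun x => (k * wmu lam x)%:E))%E.
    exact: integrableB.
  by apply/funext => x /=; rewrite mulrBl EFinB.
have inw k : mu.-integrable `]a, b[ (EFin \o (fun x => `|f x - k| * wmu lam x)).
  have := integrable_norm (idw k); rewrite (_ : _ \o _ =
    EFin \o (fun x => `|f x - k| * wmu lam x))//.
  by apply/funext => x /=; rewrite normrM (ger0_norm (wmu_ge0 x)).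
set m := meanB lam f a b.
set W := Rintegral mu `]a, b[ (wmu lam) in W0.
have ZW k : Rintegral mu `]a, b[ (fun x => k * wmu lam x) = k * W.
  exact: RintegralZl.
have cm : `|c - m| * W <= Rintegral mu `]a, b[ (fun x => `|f x - c| * wmu lam x).
  have -> : `|c - m| * W = `|Rintegral mu `]a, b[ (fun x => (f x - c) * wmu lam x)|.
    have -> : (fun x => (f x - c) * wmu lam x) =
       (fun x => f x * wmu lam x - c * wmu lam x).
      by apply/funext => x; rewrite mulrBl.
    have /= -> := @RintegralB _ _ _ mu `]a, b[ _ _ _ fw (icw c) => //.
    rewrite -/W (ZW c) -{1}(gtr0_norm W0) -normrM.
    by rewrite /m /meanB -/W !mulrBl divfK ?gt_eqF// -opprB normrN.
  apply: le_trans (le_normr_Rintegral _ (idw c)) _ => //.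
  under eq_Rintegral do rewrite normrM (ger0_norm (wmu_ge0 _)).
  exact: lexx.
apply: (@le_trans _ _ (Rintegral mu `]a, b[
    (fun x => `|f x - c| * wmu lam x + `|c - m| * wmu lam x))).
  apply: le_Rintegral => //.
    rewrite (_ : _ \o _ = (fun x => (`|f x - c| * wmu lam x)%:E) \+
      (fun x => (`|c - m| * wmu lam x)%:E))%E//.
    exact: (integrableD _ (inw c) (icw _)).
  move=> x _; rewrite -mulrDl ler_wpM2r ?wmu_ge0//.
  by rewrite (le_trans _ (ler_normD _ _))// addrA subrK.
have /= -> := @RintegralD _ _ _ mu `]a, b[ _ _ _ (inw c) (icw `|c - m|) => //.
rewrite ZW.
by rewrite mulrDl mul1r lerD2l.
Qed.

(** This is ln s <= s at s = (b/x)^(2 lam), multiplied by the weight at [x]: the weight absorbs the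
    logarithmic singularity at 0. *)
Lemma ln_div_wmu_le (b x : R) : 0 < x -> x < b ->
  (ln b - ln x) * wmu lam x <= wmu lam b / (2 * lam).
Proof.
move=> x0 xb; have b0 := lt_trans x0 xb.
have bx0 : 0 < b / x by rewrite divr_gt0.
have -> : wmu lam b = (b / x) `^ (2 * lam) * wmu lam x.
  by rewrite /wmu -powRM ?(ltW x0) ?(ltW bx0)// divfK// gt_eqF.
rewrite mulrAC ler_wpM2r ?wmu_ge0// ler_pdivlMr// mulrC.
rewrite -ln_div ?posrE// -ln_powR ltW// ln_sublinear//.
exact: powR_gt0.
Qed.

(** The weighted logarithm is bounded, even for [a = 0]: |ln x| <= |ln b| + (ln b - ln x), and
    [ln_div_wmu_le] controls the second term. *)
Lemma integrable_ln_wmu (a b : R) : 0 <= a -> a < b ->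
  mu.-integrable `]a, b[ (fun x => (ln x * wmu lam x)%:E).
Proof.
move=> a0 ab; apply: (@integrable_itvoo_bounded _ _ _ _
  (`|ln b| * wmu lam b + wmu lam b / (2 * lam))).
  apply: measurable_funM; last exact: measurable_wmu.
  by apply: measurable_funTS; exact: measurable_ln.
move=> x /andP[ax xb]; have x0 := le_lt_trans a0 ax.
have lxb : ln x <= ln b by rewrite ler_ln ?posrE ?(ltW xb) ?(lt_trans x0 xb).
rewrite normrM (ger0_norm (wmu_ge0 x)).
have h : `|ln x| <= `|ln b| + (ln b - ln x).
  have := ler_norm (ln b); have := ler_norm (- ln b); rewrite normrN => ? ?.
  by rewrite ler_norml; apply/andP; split; lra.
apply: (@le_trans _ _ ((`|ln b| + (ln b - ln x)) * wmu lam x)).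
  by rewrite ler_wpM2r ?wmu_ge0.
rewrite mulrDl lerD ?ln_div_wmu_le//.
by rewrite ler_wpM2l// wmu_le ?(ltW x0) ?(ltW xb).
Qed.

Lemma BMO_ln : BMO lam (@ln R).
Proof.
split; first by move=> a b; exact: integrable_ln_wmu.
(* The outer 2 pays for replacing the mean by [ln b]. The rest is the ratio of (b - a) [wmu lam b] /
   (2 lam), which bounds the oscillation about [ln b], to the lower bound
   [wmu lam (b / 2) * ((b - a) / 2)] for the mass. *)
exists (2 * (2 `^ (2 * lam) / lam)) => a b a0 ab.
have b0 : 0 < b := le_lt_trans a0 ab.
rewrite ler_pdivrMr ?Rintegral_wmu_gt0//.
apply: le_trans (@meanB_oscillation_le _ _ _ (ln b) a0 ab _) _.
  exact: integrable_ln_wmu.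
rewrite -mulrA ler_pM2l//.
apply: (@le_trans _ _ (Rintegral mu `]a, b[ (cst (wmu lam b / (2 * lam))))).
  have bd x : a < x < b ->
      `|ln x - ln b| * wmu lam x <= wmu lam b / (2 * lam).
    move=> /andP[ax xb]; have x0 := le_lt_trans a0 ax.
    by rewrite distrC ger0_norm ?subr_ge0 ?ler_ln ?posrE// ?ln_div_wmu_le// ltW.
  apply: le_Rintegral => //.
  - apply: (@integrable_itvoo_bounded _ _ _ _ (wmu lam b / (2 * lam))).
      apply: measurable_funM; last exact: measurable_wmu.
      apply: measurableT_comp => //; apply: measurable_funB => //.
      by apply: measurable_funTS; exact: measurable_ln.
    move=> x xab; rewrite ger0_norm ?bd// mulr_ge0 ?wmu_ge0//.
  - exact: (@integrable_itvoo_bounded _ _ _ _ `|wmu lam b / (2 * lam)|).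
rewrite Rintegral_cst//.
have /= -> := lebesgue_measure_itv `]a, b[.
rewrite lte_fin ab -EFinB/=.
apply: (@le_trans _ _ (2 `^ (2 * lam) / lam * (wmu lam (b / 2) * ((b - a) / 2)))).
  have -> : wmu lam b = 2 `^ (2 * lam) * wmu lam (b / 2).
    by rewrite /wmu -powRM//; [congr (_ `^ _); field|rewrite divr_ge0// ltW].
  rewrite le_eqVlt; apply/orP; left; apply/eqP; field.
  by rewrite gt_eqF.
by rewrite ler_wpM2l ?Rintegral_wmu_ge// divr_ge0 ?powR_ge0// ltW.
Qed.

End weight.

(** * Reduction of integrals to the support of the integrand *)

Section support.
Context (d : measure_display) (T : measurableType d) (R : realType).
Variables (mu : {measure set T -> \bar R}) (S D : set T) (h : T -> R).
Hypothesis SD : S `<=` D.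
Hypothesis h0 : forall y, D y -> ~ S y -> h y = 0.

Lemma restrict_support : (EFin \o h) \_ D = (EFin \o h) \_ S.
Proof.
apply/funext => y; rewrite /patch; case: ifPn => [/set_mem Dy|nDy].
  by case: ifPn => // /negP nSy; rewrite /= h0// => Sy; apply/nSy/mem_set.
by case: ifPn => // /set_mem/SD/mem_set Dy; rewrite Dy in nDy.
Qed.

Lemma integrable_support : measurable S -> measurable D ->
  mu.-integrable S (EFin \o h) -> mu.-integrable D (EFin \o h).
Proof.
move=> mS mD /(integrable_mkcond _ mS) hS.
by apply/(integrable_mkcond _ mD); rewrite restrict_support.
Qed.

Lemma Rintegral_support : Rintegral mu D h = Rintegral mu S h.
Proof.
by rewrite /Rintegral integral_mkcond restrict_support -integral_mkcond.
Qed.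

End support.

(** * The Riesz kernel: principal values off the support, measurability and bounds *)

Section kernel.
Context {R : realType}.
Variable lam : R.
Hypothesis lam0 : 0 < lam.
Local Notation mu := (@lebesgue_measure R).

(** The singularity y = x lies beyond the support of [g]. Once eps < x - e the truncated region
    contains []0, e[], so the truncated integrals no longer depend on eps. *)
Lemma pvR_away (g : R -> R) (x e : R) : e < x ->
  (forall y, ~ (0 < y < e) -> g y = 0) ->
  mu.-integrable `]0, e[ (fun y => (Rkernel lam x y * g y * wmu lam y)%:E) ->
  pvR lam g x
    (Rintegral mu `]0, e[ (fun y => Rkernel lam x y * g y * wmu lam y)).
Proof.
move=> ex g0 intg.
pose D (eps : R) : set R := [set y | 0 < y /\ eps < `|x - y|].
have SD eps : eps < x - e -> `]0, e[ `<=` D eps.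
  move=> epsx y /=; rewrite in_itv/= => /andP[y0 ye]; split => //.
  by rewrite (lt_le_trans _ (ler_norm _))//; lra.
have h0 eps y : D eps y -> ~ `]0, e[%classic y ->
    Rkernel lam x y * g y * wmu lam y = 0.
  by move=> _; rewrite /= in_itv/= => yS; rewrite g0// mulr0 mul0r.
have mD eps : measurable (D eps).
  rewrite (_ : D eps = `]0, +oo[ `\` `[x - eps, x + eps]); last first.
    apply/seteqP; split => y; rewrite /D /= !in_itv/= andbT => -[y0].
      move=> yeps; split => //; apply/negP.
      by rewrite -ler_distlC leNgt yeps.
    by move=> /negP; rewrite -ler_distlC -ltNge; split.
  by apply: measurableD.
split.
  near=> eps; apply: (@integrable_support _ _ _ mu `]0, e[) => //.
  - apply: SD; near: eps; apply: nbhs_right_lt; lra.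
  - exact: h0.
  - exact: mD.
apply: cvg_near_cst; near=> eps.
apply: (@Rintegral_support _ _ _ mu `]0, e[ (D eps)); last exact: h0.
apply: SD; near: eps; apply: nbhs_right_lt; lra.
Unshelve. all: by end_near. Qed.

(** The angular integrand inside [Rkernel], named so that its joint measurability in [y] and [th]
    can be stated. *)
Definition Rintegrand (x y th : R) : R :=
  (x - y * cos th) * (sin th) `^ (2 * lam - 1) /
  (x ^+ 2 + y ^+ 2 - 2 * x * y * cos th) `^ (lam + 1).

Lemma measurable_Rintegrand (x : R) :
  measurable_fun setT (fun z : R * R => Rintegrand x z.1 z.2).
Proof.
rewrite /Rintegrand.
have mcos : measurable_fun setT (fun z : R * R => cos z.2).
  apply: measurableT_comp => //.
  by apply: continuous_measurable_fun; exact: continuous_cos.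
have msin : measurable_fun setT (fun z : R * R => sin z.2).
  apply: measurableT_comp => //.
  by apply: continuous_measurable_fun; exact: continuous_sin.
(* The quotient becomes a product with a negative power, whose measurability follows by
   composition. *)
under eq_fun do rewrite -powRN.
apply: measurable_funM; first apply: measurable_funM.
- by apply: measurable_funB => //; apply: measurable_funM.
- exact: (@measurableT_comp _ _ _ _ _ _ (@powR R ^~ (2 * lam - 1))).
- apply: (@measurableT_comp _ _ _ _ _ _ (@powR R ^~ (- (lam + 1)))) => //.
  apply: measurable_funB.
    by apply: measurable_funD => //; apply: measurable_funX.
  by apply: measurable_funM => //; apply: measurable_funM.
Qed.

(** Tonelli's theorem makes the angular integral of |[Rintegrand]| measurable in [y]. For 0 < y < x
    one has x - y cos th >= 0, so the absolute value changes nothing there. *)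
Lemma measurable_Rkernel (x : R) : measurable_fun `]0, x[ (Rkernel lam x).
Proof.
pose g (z : R * R) := (`|Rintegrand x z.1 z.2| * \1_(`[0, pi]%classic) z.2)%:E.
have mg : measurable_fun setT g.
  apply/measurable_EFinP; apply: measurable_funM.
    by apply: measurableT_comp => //; exact: measurable_Rintegrand.
  by apply: measurableT_comp => //; exact: measurable_indic.
have g0 z : (0 <= g z)%E by rewrite lee_fin mulr_ge0.
have mF := @measurable_fun_fubini_tonelli_F _ _ _ _ R mu g mg g0.
apply: (@eq_measurable_fun _ _ _ _ _
    (fun y => - (2 * lam / pi) * fine (fubini_F mu g y))); last first.
  apply: measurable_funTS; apply: measurable_funM => //.
  by apply: measurableT_comp => //.
move=> y; rewrite inE/= in_itv/= => /andP[y0 yx].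
rewrite /Rkernel /fubini_F; congr (_ * fine _).
rewrite [RHS]integral_mkcond; apply: eq_integral => th _.
rewrite /g/= indicE /patch; case: ifPn => thpi; rewrite ?mulr1 ?mulr0//.
congr EFin; rewrite /= ger0_norm//.
rewrite /Rintegrand mulr_ge0 ?invr_ge0 ?powR_ge0// mulr_ge0 ?powR_ge0//.
rewrite subr_ge0 (le_trans _ (ltW yx))//.
by rewrite ler_piMr ?cos_le1// ltW.
Qed.

Let sinI := Rintegral mu `[0, pi] (fun th : R => sin th `^ (2 * lam - 1)).
(** [cl] and [cu] arise by integrating the two sides of [Rintegrand_bounds] below over the angle. *)
Let cl := 2 * lam / pi * (2^-1 / 9 `^ (lam + 1) * sinI).
Let cu := 2 * lam / pi * (3 / 4^-1 `^ (lam + 1) * sinI).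

(** The numerator factor x - y cos th lies in [1/2, 3], and the base of the power in the denominator
    lies between (x - y)^2 >= 1/4 and (x + y)^2 <= 9. *)
Lemma Rintegrand_bounds (x y th : R) : 1 <= x <= 2 -> 0 < y <= 4^-1 ->
  2^-1 / 9 `^ (lam + 1) * sin th `^ (2 * lam - 1) <= Rintegrand x y th
  <= 3 / 4^-1 `^ (lam + 1) * sin th `^ (2 * lam - 1).
Proof.
move=> /andP[x1 x2] /andP[y0 y4].
have c1 := cos_le1 th; have c2 := cos_geN1 th.
have lam1 : 0 <= lam + 1 by rewrite addr_ge0// ltW.
have s0 : 0 <= sin th `^ (2 * lam - 1) by exact: powR_ge0.
rewrite /Rintegrand; set Q := x ^+ 2 + _ - _; set s := sin th `^ _ in s0 *.
have xy0 : 0 <= x * y by rewrite mulr_ge0//; lra.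
(* Q - (x - y)^2 = 2xy(1 - cos th) and (x + y)^2 - Q = 2xy(1 + cos th); with these signs known, the
   bounds on [Q] are linear arithmetic. *)
have xy1 : 0 <= x * y * (1 - cos th) by rewrite mulr_ge0//; lra.
have xy2 : 0 <= x * y * (1 + cos th) by rewrite mulr_ge0//; lra.
have xBy : 2^-1 * 2^-1 <= (x - y) * (x - y) by rewrite ler_pM//; lra.
have xDy : (x + y) * (x + y) <= 3 * 3 by rewrite ler_pM//; lra.
have Ql : 4^-1 <= Q by rewrite /Q; lra.
have Qu : Q <= 9 by rewrite /Q; lra.
have Q0 : 0 < Q by lra.
have Pl : 4^-1 `^ (lam + 1) <= Q `^ (lam + 1).
  by rewrite ge0_ler_powR ?nnegrE ?(ltW Q0).
have Pu : Q `^ (lam + 1) <= 9 `^ (lam + 1).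
  by rewrite ge0_ler_powR ?nnegrE ?(ltW Q0).
have P0 : 0 < 4^-1 `^ (lam + 1) :> R by rewrite powR_gt0.
have P1 : 0 < Q `^ (lam + 1) by rewrite powR_gt0.
have yc1 : 0 <= y * (1 - cos th) by rewrite mulr_ge0//; lra.
have yc2 : 0 <= y * (1 + cos th) by rewrite mulr_ge0//; lra.
rewrite [in X in _ <= X <= _]mulrAC; apply/andP; split; rewrite ler_wpM2r//.
  apply: ler_pM; [by []|by rewrite invr_ge0 powR_ge0|lra|].
  by rewrite lef_pV2 ?posrE// (lt_le_trans P1).
apply: ler_pM; [lra|by rewrite invr_ge0 powR_ge0|lra|].
by rewrite lef_pV2 ?posrE.
Qed.

Lemma Rkernel_bounds :
  exists c K : R, 0 < c /\ forall x y, 1 <= x <= 2 -> 0 < y <= 4^-1 ->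
    - K <= Rkernel lam x y <= - c.
Proof.
have lam2 : 0 < 2 * lam by rewrite mulr_gt0.
have sinI0 : 0 < sinI by exact: Rintegral_sin_powR_gt0.
have kp : 0 < 2 * lam / pi by rewrite divr_gt0// pi_gt0.
exists cl, cu; split.
  by rewrite /cl !mulr_gt0// ?invr_gt0 ?powR_gt0// pi_gt0.
move=> x y hx hy.
have iS := @integrable_sin_powR R _ lam2.
have iZ k : mu.-integrable `[0, pi] (EFin \o (fun th : R => k * sin th `^ (2 * lam - 1))).
  exact: (integrableZl _ k iS).
(* Domination by a multiple of the sine power. Finiteness matters: [Rintegral] sends an infinite
   integral to the default value 0, which would destroy the strict sign of the kernel. *)
have iI : mu.-integrable `[0, pi] (EFin \o Rintegrand x y).
  apply: le_integrable (iZ (3 / 4^-1 `^ (lam + 1))) => //.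
    apply/measurable_EFinP; apply: measurable_funTS.
    exact: (measurableT_comp (measurable_Rintegrand x) (pair1_measurable y)).
  move=> th _ /=; have /andP[h1 h2] := Rintegrand_bounds x y th hx hy.
  rewrite lee_fin !ger0_norm//.
    by rewrite mulr_ge0 ?powR_ge0// divr_ge0 ?powR_ge0.
  by rewrite (le_trans _ h1)// mulr_ge0 ?powR_ge0// divr_ge0 ?powR_ge0.
rewrite /Rkernel mulNr !lerN2 /cl /cu !ler_pM2l//.
rewrite -/(Rintegrand x y) /sinI -!RintegralZl//.
apply/andP; split; apply: le_Rintegral => //; try exact: iZ.
  by move=> th _; have /andP[] := Rintegrand_bounds x y th hx hy.
by move=> th _; have /andP[] := Rintegrand_bounds x y th hx hy.
Qed.

End kernel.

(** * Lower bound for the commutator on the indicator of []0, e[] *)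

Section commutator.
Context {R : realType}.
Variables (lam : R) (c K e : R).
Hypothesis lam0 : 0 < lam.
Hypothesis kernel_bounds : forall x y : R, 1 <= x <= 2 -> 0 < y <= 4^-1 ->
  - K <= Rkernel lam x y <= - c.
Hypothesis c0 : 0 < c.
Hypothesis e0 : 0 < e.
Hypothesis e4 : e < 4^-1.
Local Notation mu := (@lebesgue_measure R).
Local Notation f := (\1_(`]0, e[%classic : set R) : R -> R).

Let f1 (y : R) : 0 < y < e -> f y = 1.
Proof. by move=> ye; rewrite indicE mem_set//= in_itv/=. Qed.

Let f0 (y : R) : ~ (0 < y < e) -> f y = 0.
Proof. by move=> ye; rewrite indicE memNset//= in_itv/=. Qed.

Let Se : `]0, e[%classic `<=` `]0, +oo[%classic.
Proof. by move=> y /=; rewrite !in_itv/= andbT => /andP[]. Qed.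

Lemma L1mu_indic : L1mu lam f.
Proof.
apply: (@integrable_support _ _ _ mu `]0, e[) => //.
- by move=> y _; rewrite /= in_itv/= => /f0 ->; rewrite mul0r.
- apply: eq_integrable (@integrable_wmu _ _ lam0 0 e (lexx _)) => //.
  by move=> y; rewrite inE/= in_itv/= => /f1 ->; rewrite mul1r.
Qed.

Lemma L1norm_indic : L1norm lam f = Rintegral mu `]0, e[ (wmu lam).
Proof.
rewrite /L1norm (@Rintegral_support _ _ _ mu `]0, e[)//; last first.
  by move=> y _; rewrite /= in_itv/= => /f0 ->; rewrite normr0 mul0r.
apply: eq_Rintegral => y; rewrite inE/= in_itv/= => /f1 ->.
by rewrite normr1 mul1r.
Qed.

Let integrable_Rkernel (x : R) (g : R -> R) : 1 <= x <= 2 ->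
  mu.-integrable `]0, e[ (fun y => (g y * wmu lam y)%:E) ->
  mu.-integrable `]0, e[ (fun y => (Rkernel lam x y * g y * wmu lam y)%:E).
Proof.
move=> hx ig; have /andP[x1 _] := hx; have [C0 E4] := (c0, e4).
have mk : measurable_fun `]0, e[ (Rkernel lam x).
  have ex : e <= x by lra.
  apply: measurable_funS (measurable_Rkernel lam x) => //.
  by apply: subset_itvl; rewrite bnd_simp.
have bk : [bounded Rkernel lam x y | y in `]0, e[%classic].
  (* Kernel values lie in [-K, -c] with c > 0, so |K| bounds their absolute values. *)
  exists `|K|; split; first exact: num_real.
  move=> N KN y /=; rewrite in_itv/= => /andP[y0 ye].
  have y4 : 0 < y <= 4^-1 by rewrite y0/=; lra.
  have /andP[k1 k2] := kernel_bounds x y hx y4.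
  have := ler_norm K; have := normr_ge0 K.
  by rewrite ler_norml => ? ?; apply/andP; split; lra.
have := @integrableMr _ _ _ mu `]0, e[ (measurable_itv _) _ _ mk bk ig.
apply: eq_integrable => //.
by move=> y _ /=; rewrite -EFinM mulrA.
Qed.

(** As e < 1 <= x, both principal values are plain integrals over []0, e[]. Their combination has an
    integrand of constant sign, of size at least c (- ln e) times the weight. *)
Lemma comm_gt_indic (x t : R) : 1 <= x <= 2 ->
  t < c * (- ln e) * L1norm lam f -> comm_gt lam (@ln R) f t x.
Proof.
move=> hx tlt; have /andP[x1 x2] := hx; have [C0 E4] := (c0, e4).
have ie : mu.-integrable `]0, e[ (fun y => (wmu lam y)%:E).
  exact: integrable_wmu.
have i1 : mu.-integrable `]0, e[ (fun y => (f y * wmu lam y)%:E).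
  apply: eq_integrable ie => // y; rewrite inE/= in_itv/= => /f1 ->.
  by rewrite mul1r.
have i2 : mu.-integrable `]0, e[ (fun y => (ln y * f y * wmu lam y)%:E).
  apply: eq_integrable (@integrable_ln_wmu _ _ lam0 0 e (lexx _) e0) => //.
  by move=> y; rewrite inE/= in_itv/= => /f1 ->; rewrite mulr1.
have k1 := integrable_Rkernel x _ hx i1.
have k2 := integrable_Rkernel x (fun y => ln y * f y) hx i2.
have ex : e < x by lra.
have p1 := pvR_away lam _ x e ex f0 k1.
have p2 := pvR_away lam (fun y => ln y * f y) x e ex _ k2.
eexists; eexists; split; [exact: p1|split; first apply: p2].
  by move=> y /f0 ->; rewrite mulr0.
(* The sign is flipped so that the difference inside the absolute value is the nonnegative one. *)
rewrite (lt_le_trans tlt)// -normrN opprB (le_trans _ (ler_norm _))//.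
have kx : mu.-integrable `]0, e[
   (fun y => (ln x * (Rkernel lam x y * f y * wmu lam y))%:E).
  exact: (integrableZl _ (ln x) k1).
have -> : ln x * Rintegral mu `]0, e[ (fun y => Rkernel lam x y * f y * wmu lam y)
  = Rintegral mu `]0, e[ (fun y => ln x * (Rkernel lam x y * f y * wmu lam y)).
  by apply/esym; exact: RintegralZl.
have /= <- := @RintegralB _ _ _ mu `]0, e[ _ _ _ k2 kx => //.
rewrite L1norm_indic.
have /= <- := @RintegralZl _ _ _ mu `]0, e[ _ (c * - ln e) _ ie => //.
apply: le_Rintegral => //.
- exact: (integrableZl _ _ ie).
- exact: (integrableB _ k2 kx).
move=> y /=; rewrite in_itv/= => ye; have /andP[y0 yle] := ye.
rewrite f1// !mulr1 mulrA -mulrBl ler_wpM2r ?wmu_ge0//.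
have y4 : 0 < y <= 4^-1 by rewrite y0/=; lra.
have /andP[_ kc] := kernel_bounds x y hx y4.
have lx : 0 <= ln x by exact: ln_ge0.
have ly : ln y <= ln e by rewrite ler_ln ?posrE// ltW.
have le0 : ln e < 0 by rewrite ln_lt0// e0/=; lra.
(* Both [Rkernel lam x y] and ln y - ln x are negative; their product is rewritten with -R >= c and
   ln x - ln y >= - ln e, the latter because ln x >= 0. *)
rewrite (mulrC (ln x)) -mulrBr -[leRHS]mulrNN opprB.
by apply: ler_pM; lra.
Qed.

End commutator.

(** * Contradiction with a weak type bound *)

Theorem theorem1p13 (R : realType) (lam : R) (hlam : 0 < lam) :
  exists b0 : R -> R, BMO lam b0 /\
    ~ (exists C : R, forall (f : R -> R) (t : R), L1mu lam f -> 0 < t ->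
         forall A : set R, measurable A ->
           A `<=` [set x | 0 < x /\ comm_gt lam b0 f t x] ->
           (muB lam A <= (C / t * L1norm lam f)%:E)%E).
Proof.
exists (@ln R); split; first exact: BMO_ln.
move=> [C weak11].
have [c [K [c0 kb]]] := Rkernel_bounds lam hlam.
(* [N] is - ln e. The 4 forces e < 1/4, since exp N >= 1 + N; the other term gives 2C/(cN) < 1. *)
pose N := 4 + `|2 * C / c|; pose e := expR (- N).
have N4 : 4 <= N by rewrite lerDl.
have e0 : 0 < e by exact: expR_gt0.
have e4 : e < 4^-1.
  rewrite /e expRN ltf_pV2 ?posrE ?expR_gt0//.
  by rewrite (lt_le_trans _ (expR_ge1Dx _))//; lra.
have lne : - ln e = N by rewrite /e expRK opprK.
pose f : R -> R := \1_(`]0, e[%classic : set R).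
have f0 : 0 < L1norm lam f by rewrite L1norm_indic Rintegral_wmu_gt0.
(* Half the lower bound for the commutator: the inequality is strict on all of [[1, 2]], and the
   norm of [f] cancels in the weak type bound, leaving 2C/(cN). *)
pose t := c * N * L1norm lam f / 2.
have T0 : 0 < c * N * L1norm lam f by rewrite !mulr_gt0//; lra.
have t0 : 0 < t by rewrite divr_gt0.
have Asub : `[1, 2]%classic `<=` [set x | 0 < x /\ comm_gt lam (@ln R) f t x].
  move=> x /=; rewrite in_itv/= => hx; have /andP[x1 x2] := hx.
  split; first lra.
  apply: (comm_gt_indic lam c K e hlam kb c0 e0 e4 x t hx).
  by rewrite lne -/f /t; lra.
have := weak11 f t (L1mu_indic lam e hlam) t0 `[1, 2]%classic (measurable_itv _) Asub.
apply/negP; rewrite -ltNge.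
(* The value 1 separates the two sides: the weak type bound is below 1, while the weight is at least
   1 on [[1, 2]], an interval of length 1. *)
apply: (@lt_le_trans _ _ 1%E).
  rewrite lte_fin.
  have -> : C / t * L1norm lam f = 2 * C / c / N.
    by rewrite /t; field; rewrite !gt_eqF//; lra.
  rewrite ltr_pdivrMr; last lra.
  by rewrite mul1r /N (le_lt_trans (ler_norm _))//; lra.
have <- : (\int[lebesgue_measure]_(x in `[1%R, 2%R]) (cst 1 x) = 1 :> \bar R)%E.
  rewrite integral_cst// mul1e.
  have /= -> := lebesgue_measure_itv `[(1:R), 2].
  by rewrite lte_fin ltr1n -EFinB; congr EFin; lra.
apply: ge0_le_integral => //.
- by apply/measurable_EFinP; exact: measurable_wmu.
- move=> x /=; rewrite in_itv/= => /andP[x1 _]; rewrite lee_fin.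
  have <- : wmu lam 1 = 1 by rewrite /wmu powR1.
  exact: wmu_le.
Qed.
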